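(* Let $N\in\mathbb{N}$, $N\geqslant 2$, and let $f:[0,1]\times\mathbb{R}\to\mathbb{R}$ satisfy: (C(c)) $f$ is continuous on $[0,1]\times\mathbb{R}$ and has a continuous partial derivative $f_x$ with respect to the second variable; (D(f)) there exist positive constants $A,B$ with $A<1$ such that $|f(t,x)|\leqslant A|x|+B$ for all $t\in[0,1]$, $x\in\mathbb{R}$; (D($f_x$)) $\inf_{[0,1]\times\mathbb{R}} f_x>-1$. Then the operator $D_N:(\mathbb{E}_N,\|\cdot\|_{\mathbb{E}_N})\to(\mathbb{E}_N,\|\cdot\|_N)$ is a diffeomorphism.
   Context: $\mathbb{E}_N$ is the space of functions $x:\{0,1,\dots,N\}\to\mathbb{R}$ with $x(0)=x(N)=0$ (extended by $x(k)=0$ for $k\notin\{0,\dots,N\}$). $\Delta x(k-1)=x(k)-x(k-1)$, $\Delta^2 x(k-1)=x(k+1)-2x(k)+x(k-1)$. Norms: $\|x\|_N=(\sum_{i=1}^{N-1}|x(i)|^2)^{1/2}$, $\|x\|_{\mathbb{E}_N}=(\sum_{i=1}^{N-1}|\Delta^2x(i-1)|^2)^{1/2}$. The operator $D_N$ is defined by $(D_Nx)(k)=\Delta^2x(k-1)-\frac{1}{N^2}f(\frac{k}{N},x(k))$ for $k=1,\dots,N-1$ and $(D_Nx)(0)=(D_Nx)(N)=0$. A diffeomorphism is a $C^1$ bijection with $C^1$ inverse. *)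

(* Defs.v *)
From HB Require Import structures.
From mathcomp Require Import all_boot all_order all_algebra.
From mathcomp Require Import all_classical all_reals all_analysis.
Set Implicit Arguments. Unset Strict Implicit. Unset Printing Implicit Defensive.
Import Order.TTheory GRing.Theory Num.Theory.
Import numFieldNormedType.Exports.
Local Open Scope ring_scope.
Local Open Scope classical_set_scope.

(* An element of E_N (functions on {0,..,N} vanishing at 0 and N) is
   represented by its interior values x(1),...,x(N-1), i.e. by a row
   vector of size N.-1.  [extE x k] recovers x(k) for every k : nat,
   with x(k) = 0 for k outside {1,...,N-1}. *)
Definition extE (R : realType) (n : nat) (x : 'rV[R]_n) (k : nat) : R :=
  if (0 < k)%N then
    (if @insub nat (fun j => (j < n)%N) _ k.-1 is Some i then x ord0 i else 0)
  else 0.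

(* The operator D_N, restricted to interior points k = 1,...,N-1
   (its values at 0 and N are 0 by definition). Component i corresponds
   to k = i+1. *)
Definition DN (R : realType) (N : nat) (f : R -> R -> R) (x : 'rV[R]_(N.-1))
  : 'rV[R]_(N.-1) :=
  \row_(i < N.-1)
    (extE x i.+2 - 2 * extE x i.+1 + extE x i
     - (N%:R ^+ 2)^-1 * f (i.+1%:R / N%:R) (extE x i.+1)).

(* C^1 map between finite-dimensional normed spaces: differentiable
   everywhere with continuous derivative x |-> 'd F x (continuity of the
   derivative is expressed pointwise in the direction v, which in finite
   dimension is equivalent to continuity in operator norm). *)
Definition C1map (R : realType) (U V : normedModType R) (F : U -> V) : Prop :=
  (forall x, differentiable F x) /\ (forall v : U, continuous (fun x => 'd F x v)).

Definition diffeomorphism (R : realType) (U V : normedModType R) (F : U -> V)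
  : Prop :=
  exists G : V -> U, [/\ cancel F G, cancel G F, C1map F & C1map G].

(* Main.v *)
(* The discrete Poincare inequality and f_x >= c > -1 give, with h = x - y,
   <h, D_N x - D_N y> <= - (1 + c) / N^2 |h|^2, so |h| <= K |D_N x - D_N y| for
   some K > 0.  A C^1 self-map F of R^n with such a bound has, by passing to the
   limit, |v| <= K |F'(x) v|, so F'(x) is invertible.  Then |F - y| is coercive
   and its minimum is a solution of F x = y, and the inverse map is K-Lipschitz
   with derivative F'(x)^-1, which depends continuously on x because
   w_i = F'(x_i)^-1 v satisfy |w_1 - w_2| <= K |(F'(x_1) - F'(x_2)) w_2|. *)
Require Import Defs.
From HB Require Import structures.
From mathcomp Require Import all_boot all_order all_algebra.
From mathcomp Require Import all_classical all_reals all_analysis.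
From mathcomp Require Import ring lra.
Import Order.TTheory GRing.Theory Num.Theory.
Import numFieldNormedType.Exports.
Local Open Scope ring_scope.
Local Open Scope classical_set_scope.

Set Implicit Arguments.
Unset Strict Implicit.
Unset Printing Implicit Defensive.

(** * Differentiability in epsilon form *)

Lemma diff_nbhs_le (R : realType) (V W : normedModType R) (F : V -> W) (x : V) :
  differentiable F x -> forall e : R, 0 < e ->
  \forall h \near (0 : V), `|F (h + x) - F x - 'd F x h| <= e * `|h|.
Proof.
move=> /diff_locally dF e e0.
have /eqaddoP/(_ e e0) := dF.
by apply: filterS => h /=; rewrite /cst opprD addrA.
Qed.

Lemma is_diff_nbhs_le (R : realType) (V W : normedModType R) (F : V -> W)
    (D : {linear V -> W}) (x : V) : continuous D ->
  (forall e : R, 0 < e ->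
    \forall h \near (0 : V), `|F (h + x) - F x - D h| <= e * `|h|) ->
  is_diff x F D.
Proof.
move=> cD FD.
have E : F \o shift x = cst (F x) + D +o_ 0 id.
  apply/eqaddoP => e e0; have := FD e e0.
  by apply: filterS => h /=; rewrite /cst opprD addrA.
have dE := diff_unique cD E.
by apply: DiffDef => //; apply/diff_locallyP; rewrite dE.
Qed.

(** * Global inversion of a [C1map] with a lower Lipschitz bound *)

Section ExpandingMap.
Variables (R : realType) (n : nat) (F : 'rV[R]_n -> 'rV[R]_n) (K : R).
Hypotheses (K0 : 0 < K) (C1F : C1map F).
Hypothesis expF : forall x y, `|x - y| <= K * `|F x - F y|.

Lemma expanding_injective : injective F.
Proof.
move=> x y Fxy; apply/eqP; rewrite -subr_eq0 -normr_le0.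
by have := expF x y; rewrite Fxy subrr normr0 mulr0.
Qed.

Lemma expanding_diff x v : `|v| <= K * `|'d F x v|.
Proof.
have [->|v0] := eqVneq v 0; first by rewrite normr0 mulr_ge0// ltW.
have nv : 0 < `|v| by rewrite normr_gt0.
apply/ler_addgt0Pr => e e0.
(* Chosen so that the first-order error at [t *: v], multiplied by [K], is [t * e]; the factor [t]
   then cancels. *)
pose e' := e / (K * `|v|).
have e'0 : 0 < e' by rewrite divr_gt0// mulr_gt0.
have := diff_nbhs_le (C1F.1 x) e'0 => /nbhs_norm0P[d /= d0 Hd].
pose t := d / 2 / `|v|.
have t0 : 0 < t by rewrite !divr_gt0.
have nt : `|t *: v| = t * `|v| by rewrite normrZ gtr0_norm.
have /Hd : `|t *: v| < d by rewrite nt /t divfK ?gt_eqF//; lra.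
rewrite nt linearZ /= => H.
have := expF (t *: v + x) x; rewrite addrK nt => H2.
have : `|F (t *: v + x) - F x| <= t * `|'d F x v| + e' * (t * `|v|).
  rewrite -[X in `|X|](subrK (t *: 'd F x v)).
  rewrite (le_trans (ler_normD _ _))// [leRHS]addrC lerD//.
    by rewrite normrZ gtr0_norm.
move=> /(ler_wpM2l (ltW K0)) /(le_trans H2).
rewrite (_ : K * (_ + _) = t * (K * `|'d F x v| + e)) ?ler_pM2l//.
by rewrite /e'; field; rewrite !gt_eqF.
Qed.

(** The lower bound on the derivative makes its kernel trivial, and the matrix is square. *)
Lemma expanding_jacobian_unit x : jacobian F x \in unitmx.
Proof.
rewrite -row_free_unit; apply: inj_row_free => v.
rewrite /jacobian mul_rV_lin1 => dv0; apply/eqP; rewrite -normr_le0.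
by have := expanding_diff x v; rewrite dv0 normr0 mulr0.
Qed.

Lemma expanding_diff_inv x v : 'd F x (v *m invmx (jacobian F x)) = v.
Proof.
by rewrite -mul_rV_lin1 -/(jacobian F x) mulmxKV// expanding_jacobian_unit.
Qed.

Lemma expanding_continuous : continuous F.
Proof. by move=> x; apply: differentiable_continuous; exact: C1F.1. Qed.

(* A minimiser of |F x - y| must be a solution: otherwise moving x in the
   direction v with F'(x) v = y - F x decreases the norm to first order. *)
Lemma expanding_surjective y : exists x, F x = y.
Proof.
pose g x : R := `|F x - y|.
have cg : continuous g.
  move=> x; apply: (@cvg_norm _ _ _ (nbhs x) _ (fun z => F z - y)).
  by apply: cvgB; [exact: expanding_continuous|exact: cvg_cst].
(* Beyond this radius [|x| <= K * (g x + g 0)] forces [g x > g 0], so a minimum over the ball is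
   global. *)
pose M := 2 * K * g 0.
pose A := [set x : 'rV[R]_n | `|x| <= M].
have M0 : 0 <= M by rewrite !mulr_ge0 ?normr_ge0// ltW.
have A0 : A 0 by rewrite /A /= normr0.
have An0 : A !=set0 by exists 0.
have cA : compact A.
  apply: bounded_closed_compact.
    exists M; split; first exact: num_real.
    by move=> r Mr x /= Ax; apply: le_trans (ltW Mr).
  apply: (@closed_comp _ _ (fun x : 'rV[R]_n => `|x|) [set r | r <= M]).
    by move=> x _; exact: norm_continuous.
  exact: closed_le.
have [x0 Ax0 min0] := EVT_min_rV An0 cA (continuous_subspaceT cg).
have {}min0 x : g x0 <= g x.
  have [xM|xM] := leP `|x| M; first by apply: min0; rewrite inE.
  apply: (le_trans (min0 0 _)); first by rewrite inE.
  have := expF x 0; rewrite subr0 => Hx.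
  have : `|F x - F 0| <= g x + g 0.
    by rewrite /g [X in _ <= _ + X]distrC -[F x - F 0](subrKA y) ler_normD.
  move=> /(ler_wpM2l (ltW K0)) /(le_trans Hx) /(lt_le_trans xM).
  by rewrite /M mulrAC mulrC mulrA -mulrA ltr_pM2l//; lra.
exists x0; apply/eqP; rewrite -subr_eq0 -normr_le0 leNgt; apply/negP.
rewrite -/(g x0) => g0.
pose v := (y - F x0) *m invmx (jacobian F x0).
have dv : 'd F x0 v = y - F x0 by exact: expanding_diff_inv.
have v0 : 0 < `|v|.
  rewrite normr_gt0; apply/eqP => v0; move: g0.
  by rewrite /g distrC -dv v0 linear0 normr0 ltxx.
(* The linear part lowers the norm by [t * g x0]; with this [e] the error gives back at most half of
   that. *)
pose e := g x0 / (2 * `|v|).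
have e0 : 0 < e by rewrite divr_gt0// mulr_gt0.
have := diff_nbhs_le (C1F.1 x0) e0 => /nbhs_norm0P[d /= d0 Hd].
(* The cap at 1 keeps [1 - t] nonnegative, so it comes out of the norm unchanged. *)
pose t := Num.min (d / 2 / `|v|) 1.
have t0 : 0 < t by rewrite lt_min ltr01 !divr_gt0.
have t1 : t <= 1 by rewrite ge_min lexx orbT.
have nt : `|t *: v| = t * `|v| by rewrite normrZ gtr0_norm.
have /Hd : `|t *: v| < d.
  rewrite nt (@le_lt_trans _ _ (d / 2))//; last lra.
  by rewrite -ler_pdivlMr// ge_min lexx.
rewrite nt linearZ /= dv => H.
have := min0 (t *: v + x0); rewrite leNgt => /negP; apply.
rewrite {1}/g.
have -> : F (t *: v + x0) - y =
    (F (t *: v + x0) - F x0 - t *: (y - F x0)) + (1 - t) *: (F x0 - y).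
  apply/rowP => i; rewrite !mxE; ring.
rewrite (le_lt_trans (ler_normD _ _))// normrZ -/(g x0) ger0_norm ?subr_ge0//.
rewrite (le_lt_trans (lerD H (lexx _)))//.
rewrite (_ : e * _ = t * g x0 / 2); first nra.
by rewrite /e; field; rewrite gt_eqF.
Qed.

(** * Regularity of the inverse map *)

Section Inverse.
Variable G : 'rV[R]_n -> 'rV[R]_n.
Hypothesis GK : cancel G F.

Lemma expanding_inverse_lipschitz y z : `|G y - G z| <= K * `|y - z|.
Proof. by have := expF (G y) (G z); rewrite !GK. Qed.

(** With [k = G (h + y) - G y] and [D] the inverse derivative, [k - D h] is [D] applied to minus the
    first-order error of [F] at [G y] along [k]. *)
Lemma expanding_inverse_diff y :
  is_diff y G (fun v => v *m invmx (jacobian F (G y))).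
Proof.
pose D : {linear 'rV[R]_n -> 'rV[R]_n} := mulmxr (invmx (jacobian F (G y))).
have DK v : `|D v| <= K * `|v|.
  by rewrite (le_trans (expanding_diff (G y) _))// expanding_diff_inv.
have KD v : D ('d F (G y) v) = v.
  by rewrite /= -mul_rV_lin1 mulmxK// expanding_jacobian_unit.
apply: (@is_diff_nbhs_le _ _ _ _ D).
  apply/linear_bounded_continuous/linear_boundedP.
  by exists K; split; [exact: num_real|move=> r Kr x;
    rewrite (le_trans (DK _))// ler_wpM2r// ltW].
move=> e e0.
(* One factor [K] pays for the bound on [D], the other for the Lipschitz bound on [G]. *)
have e'0 : 0 < e / (K * K) by rewrite divr_gt0// mulr_gt0.
have := diff_nbhs_le (C1F.1 (G y)) e'0 => /nbhs_norm0P[d /= d0 Hd].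
apply/nbhs_norm0P; exists (d / K); first by rewrite /= divr_gt0.
move=> h /= hd.
have Gh : `|G (h + y) - G y| <= K * `|h|.
  by rewrite (le_trans (expanding_inverse_lipschitz _ _))// addrK.
have /Hd : `|G (h + y) - G y| < d.
  by rewrite (le_lt_trans Gh)// mulrC -ltr_pdivlMr.
rewrite subrK !GK addrK => H.
rewrite -[G (h + y) - G y]KD -linearB (le_trans (DK _))// distrC.
rewrite (le_trans (ler_wpM2l (ltW K0) H))//.
rewrite (_ : K * (_ * _) = e / K * `|G (h + y) - G y|); last first.
  by field; rewrite gt_eqF.
rewrite (le_trans (ler_wpM2l _ Gh)) ?divr_ge0 ?(ltW e0) ?(ltW K0)//.
by rewrite mulrA divfK ?gt_eqF.
Qed.

Lemma expanding_inverse_C1 : C1map G.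
Proof.
have dG y : differentiable G y by have [] := expanding_inverse_diff y.
split=> // v y0; rewrite /continuous_at.
pose D y := v *m invmx (jacobian F (G y)).
have dGE y : 'd G y v = D y.
  by rewrite (@diff_val _ _ _ _ _ _ _ (expanding_inverse_diff y)).
rewrite (funext dGE).
have dD y : 'd F (G y) (D y) = v by exact: expanding_diff_inv.
clearbody D.
(* Both derivatives send their [D] to [v]. On the right the vector [D y0] stays fixed, so continuity
   of the derivative in one direction suffices. *)
have DE y : `|D y - D y0| <= K * `|'d F (G y) (D y0) - 'd F (G y0) (D y0)|.
  have <- : 'd F (G y) (D y0 - D y) = 'd F (G y) (D y0) - 'd F (G y0) (D y0).
    have E := etrans (dD y) (esym (dD y0)).
    exact: etrans (raddfB _ _ _) (congr1 (fun w => 'd F (G y) (D y0) - w) E).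
  by rewrite distrC; exact: expanding_diff.
have cdF : {for y0, continuous (fun y => 'd F (G y) (D y0))}.
  apply: (@continuous_comp _ _ _ G (fun x => 'd F x (D y0))).
    exact: differentiable_continuous.
  exact: C1F.2.
apply/(@cvgrPdist_lt _ _ _ (nbhs y0)) => e e0.
have eK : 0 < e / K by rewrite divr_gt0.
near=> y; rewrite dGE distrC (le_lt_trans (DE _))// mulrC -ltr_pdivlMr// distrC.
near: y; exact: (@cvgr_dist_lt _ _ _ (nbhs y0) _ _ _ cdF).
Unshelve. all: by end_near. Qed.

End Inverse.

Lemma expanding_diffeomorphism : diffeomorphism F.
Proof.
(* Choice gives a right inverse; injectivity of [F] makes it two-sided. *)
have [G GK] := choice expanding_surjective.
exists G; split.
- by move=> x; apply: expanding_injective; exact: GK.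
- exact: GK.
- exact: C1F.
- exact: expanding_inverse_C1 GK.
Qed.

End ExpandingMap.

(** * Closure properties of $C^1$ maps *)

Section C1Coordinates.
Variable R : realType.

Lemma C1mapD (U V : normedModType R) (F G : U -> V) :
  C1map F -> C1map G -> C1map (fun x => F x + G x).
Proof.
move=> [dF cF] [dG cG].
have D x : is_diff x (fun x => F x + G x) ('d F x \+ 'd G x).
  by apply: is_diffD; exact: differentiableP.
split=> [x|v]; first by have [] := D x.
rewrite (_ : (fun x => _) = fun x => 'd F x v + 'd G x v).
  by move=> x; apply: cvgD; [exact: cF|exact: cG].
by apply/funext => x; rewrite (@diff_val _ _ _ _ _ _ _ (D x)).
Qed.

Lemma C1mapZ (U V : normedModType R) (a : R) (F : U -> V) :
  C1map F -> C1map (fun x => a *: F x).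
Proof.
move=> [dF cF].
have D x : is_diff x (fun x => a *: F x) (a \*: 'd F x).
  by apply: is_diffZ; exact: differentiableP.
split=> [x|v]; first by have [] := D x.
rewrite (_ : (fun x => _) = fun x => a *: 'd F x v).
  by move=> x; apply: cvgZr; exact: cF.
by apply/funext => x; rewrite (@diff_val _ _ _ _ _ _ _ (D x)).
Qed.

Lemma C1map_cst (U V : normedModType R) (a : V) : C1map (fun _ : U => a).
Proof.
split=> [x|v]; first exact: differentiable_cst.
by under eq_fun do rewrite diff_cst; move=> x; exact: cvg_cst.
Qed.

Lemma C1map_linear (U V : normedModType R) (L : {linear U -> V}) :
  continuous L -> C1map L.
Proof.
move=> cL; split=> [x|v]; first exact: linear_differentiable.
rewrite (_ : (fun x => _) = fun=> L v); first by move=> x; exact: cvg_cst.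
by apply/funext => x; rewrite diff_lin.
Qed.

Lemma C1map_coord n (i : 'I_n) : C1map (fun x : 'rV[R]_n => x ord0 i).
Proof.
have Llin : linear (fun x : 'rV[R]_n => x ord0 i).
  by move=> a u v; rewrite !mxE.
pose L : {linear 'rV[R]_n -> R} :=
  HB.pack (fun x : 'rV[R]_n => x ord0 i)
    (GRing.isLinear.Build _ _ _ _ _ Llin).
by apply: (@C1map_linear _ _ L); exact: coord_continuous.
Qed.

(** Chain rule shaped for the terms $f(t, x(k))$ with [t] fixed. *)
Lemma C1map_comp_derive (U : normedModType R) (u : U -> R) (g dg : R -> R) :
  (forall x : R, is_derive x 1 g (dg x)) -> continuous dg -> C1map u ->
  C1map (fun x => g (u x)).
Proof.
move=> Dg cdg [du cu].
have dgd x : differentiable g x by apply/derivable1_diffP; have [] := Dg x.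
have dE x h : 'd g x h = h * dg x.
  by rewrite diff1E// derive1E; have [_ ->] := Dg x.
split=> [x|v]; first exact: (@differentiable_comp _ _ _ _ u g).
rewrite (_ : (fun x => _) = fun x => 'd u x v * dg (u x)).
  move=> x; apply: cvgM; first exact: cu.
  apply: (@continuous_comp _ _ _ u dg); last exact: cdg.
  exact: differentiable_continuous.
by apply/funext => x; rewrite (@diff_comp _ _ _ _ u g)//= dE.
Qed.

Lemma C1mapZl (U V : normedModType R) (k : U -> R) (w : V) :
  C1map k -> C1map (fun x => k x *: w).
Proof.
move=> [dk ck]; split=> [x|v]; first exact: differentiableZl.
rewrite (_ : (fun x => _) = fun x => 'd k x v *: w).
  by move=> x; apply: cvgZl; exact: ck.
by apply/funext => x; rewrite diffZl.
Qed.

Lemma C1map_sum (U V : normedModType R) (I : Type) (r : seq I)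
    (F : I -> U -> V) :
  (forall i, C1map (F i)) -> C1map (fun x => \sum_(i <- r) F i x).
Proof.
move=> CF; elim: r => [|i r IHr].
  by under eq_fun do rewrite big_nil; exact: C1map_cst.
by under eq_fun do rewrite big_cons; exact: C1mapD.
Qed.

(** Expanding in the canonical basis reduces to scalar $C^1$ functions times constant vectors. *)
Lemma C1map_rV (U : normedModType R) n (F : U -> 'rV[R]_n) :
  (forall i, C1map (fun x => F x ord0 i)) -> C1map F.
Proof.
move=> CF.
have -> : F = (fun x => \sum_(i < n) F x ord0 i *: delta_mx ord0 i).
  by apply/funext => x; rewrite [LHS]row_sum_delta.
by apply: C1map_sum => i; exact: C1mapZl.
Qed.

End C1Coordinates.

(** * Summation by parts, the discrete Poincare inequality and monotonicity *)

Section DiscreteEnergy.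
Variable R : realType.

Lemma sum_by_parts_laplacian (u : nat -> R) n : u 0%N = 0 -> u n.+1 = 0 ->
  \sum_(i < n) u i.+1 * (u i.+2 - 2 * u i.+1 + u i) =
  - \sum_(i < n.+1) (u i.+1 - u i) ^+ 2.
Proof.
move=> u0 un.
(* Partial sums keep a boundary term; at [m = n], where [u n.+1 = 0], it is minus the last square of
   the energy. *)
have S m : \sum_(i < m) u i.+1 * (u i.+2 - 2 * u i.+1 + u i) =
    u m * (u m.+1 - u m) - \sum_(i < m) (u i.+1 - u i) ^+ 2.
  elim: m => [|m IHm]; first by rewrite !big_ord0 u0 mul0r subr0.
  by rewrite !big_ord_recr /= IHm; ring.
by rewrite S big_ord_recr /= un; ring.
Qed.

(** Cauchy-Schwarz for the telescoping sum of the increments of [u], by induction. *)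
Lemma sqr_le_energy (u : nat -> R) n : u 0%N = 0 ->
  u n ^+ 2 <= n%:R * \sum_(i < n) (u i.+1 - u i) ^+ 2.
Proof.
move=> u0; elim: n => [|n IHn]; first by rewrite u0 expr0n /= mul0r.
rewrite big_ord_recr /=; set T := \sum_(i < n) _ in IHn *.
set d := u n.+1 - u n.
have -> : u n.+1 = u n + d by rewrite /d; ring.
(* The inductive step divides by [n], so [n = 0] is treated apart. *)
have [n0|n0] := posnP n.
  by rewrite /T n0 u0 big_ord0 !add0r mul1r.
have {}n0 : 0 < n%:R :> R by rewrite ltr0n.
(* AM-GM: [2 u d <= u^2 / n + n d^2] *)
have : 0 <= (u n - n%:R * d) ^+ 2 / n%:R by rewrite divr_ge0 ?sqr_ge0 ?ltW.
have -> : (u n - n%:R * d) ^+ 2 / n%:R =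
    u n ^+ 2 / n%:R - 2 * u n * d + n%:R * d ^+ 2 by field; rewrite gt_eqF.
have : u n ^+ 2 / n%:R <= T by rewrite ler_pdivrMr// mulrC.
rewrite -natr1; move: IHn; nra.
Qed.

(** Each of the [n] squares is at most [n.+1] times the energy. The crude constant is enough: for
    [n.+1 = N] it matches the factor $1/N^2$ in $D_N$. *)
Lemma discrete_poincare (u : nat -> R) n : u 0%N = 0 ->
  \sum_(i < n) u i.+1 ^+ 2 <=
  n.+1%:R ^+ 2 * \sum_(i < n.+1) (u i.+1 - u i) ^+ 2.
Proof.
move=> u0; set T := \sum_(i < n.+1) _.
have T0 : 0 <= T by apply: sumr_ge0 => i _; exact: sqr_ge0.
have H (i : 'I_n) : u i.+1 ^+ 2 <= n.+1%:R * T.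
  apply: (le_trans (sqr_le_energy _ u0)).
  apply: ler_pM => //; first by apply: sumr_ge0 => j _; exact: sqr_ge0.
    by rewrite ler_nat ltnS ltnW.
  rewrite /T -[in leRHS](big_mkord xpredT (fun j => (u j.+1 - u j) ^+ 2)).
  rewrite (@big_cat_nat _ _ _ i.+1)//=; last by rewrite ltnS ltnW.
  by rewrite big_mkord lerDl; apply: sumr_ge0 => j _; exact: sqr_ge0.
apply: (le_trans (ler_sum _ (fun i _ => H i))).
rewrite sumr_const card_ord -[leLHS]mulr_natl expr2 -mulrA ler_wpM2r//.
  by rewrite mulr_ge0.
by rewrite ler_nat.
Qed.

Lemma derive_ge_monotone (g dg : R -> R) (c x y : R) :
  (forall z : R, is_derive z 1 g (dg z)) -> (forall z, c <= dg z) ->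
  c * (x - y) ^+ 2 <= (x - y) * (g x - g y).
Proof.
move=> Dg cdg.
have cg : continuous g.
  move=> z; apply: differentiable_continuous; apply/derivable1_diffP.
  by have [] := Dg z.
(* Both sides are symmetric in [x] and [y]; the mean value theorem then applies on [[y, x]]. *)
wlog yx : x y / y <= x => [H|].
  have [/H//|/ltW/H] := leP y x.
  by rewrite -(opprB y x) sqrrN -(opprB (g y)) mulrNN.
have [z _ ->] := MVT_segment yx (fun z _ => Dg z) (continuous_subspaceT cg).
by rewrite [leRHS]mulrCA -expr2 ler_wpM2r// sqr_ge0.
Qed.

End DiscreteEnergy.

(** * The sup norm of row vectors against the Euclidean pairing *)

Section SupNorm.
Variables (R : realType) (n : nat).

Lemma coord_le_norm (x : 'rV[R]_n) i : `|x ord0 i| <= `|x|.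
Proof.
by rewrite [leRHS]/Num.norm /= mx_normrE; exact: (le_bigmax _ _ (ord0, i)).
Qed.

(** The sup norm is attained at some coordinate, whose square is one term of the sum. *)
Lemma sqr_norm_le_sum (x : 'rV[R]_n) : `|x| ^+ 2 <= \sum_i x ord0 i ^+ 2.
Proof.
have S0 (P : pred 'I_n) : 0 <= \sum_(i | P i) x ord0 i ^+ 2.
  by apply: sumr_ge0 => i _; exact: sqr_ge0.
have [->|x0] := eqVneq `|x| 0; first by rewrite expr0n.
have [[j i] /= xi] := mx_norm_neq0 x0; rewrite (ord1 j) in xi.
rewrite (_ : `|x| = `|x ord0 i|)//.
by rewrite real_normK ?num_real// (bigD1 i)//= lerDl.
Qed.

(* The pairing is at most n |h| |d|, and the sum of squares at least |h|^2. *)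
Lemma coercive_norm_le (mu : R) (h d : 'rV[R]_n) : 0 < mu ->
  \sum_i h ord0 i * d ord0 i <= - mu * \sum_i h ord0 i ^+ 2 ->
  `|h| <= n%:R / mu * `|d|.
Proof.
move=> mu0 H.
have [->|h0] := eqVneq h 0; first by rewrite normr0 mulr_ge0// divr_ge0// ltW.
have {}h0 : 0 < `|h| by rewrite normr_gt0.
rewrite mulrAC ler_pdivlMr// -(ler_pM2r h0) -mulrA.
have : - (n%:R * `|d| * `|h|) <= \sum_i h ord0 i * d ord0 i.
  rewrite -mulrA mulr_natl -[X in _ *+ X]card_ord -sumr_const -sumrN.
  apply: ler_sum => i _; rewrite lerNl (le_trans (ler_norm _))// normrN normrM.
  by rewrite mulrC ler_pM// coord_le_norm.
move=> /le_trans/(_ H); have := ler_wpM2l (ltW mu0) (sqr_norm_le_sum h).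
rewrite expr2; lra.
Qed.

End SupNorm.

(** * Extension of interior values by zero *)

Section Extension.
Variables (R : realType) (n : nat).
Implicit Types x y : 'rV[R]_n.

Lemma extE_ord x (i : 'I_n) : extE x i.+1 = x ord0 i.
Proof. by rewrite /extE /= valK. Qed.

Lemma extE_out x : extE x n.+1 = 0.
Proof. by rewrite /extE /= insubF// ltnn. Qed.

Lemma extEB x y k : extE (x - y) k = extE x k - extE y k.
Proof.
rewrite /extE; case: ifP => _; last by rewrite subr0.
by case: insub => [i|]; rewrite ?mxE ?subr0.
Qed.

Lemma C1map_extE k : C1map (fun x : 'rV[R]_n => extE x k).
Proof.
rewrite /extE; case: (0 < k)%N; last exact: C1map_cst.
case: (@insub nat (fun j => (j < n)%N) _ k.-1) => [i|].
  exact: C1map_coord.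
exact: C1map_cst.
Qed.

End Extension.

(** * Smoothness and coercivity of $D_N$ *)

Section Operator.
Variables (R : realType) (N : nat) (f fx : R -> R -> R) (c : R).
Hypothesis N2 : (2 <= N)%N.
Hypothesis fD :
  forall t x : R, 0 <= t <= 1 -> is_derive x 1 (f t) (fx t x).
Hypothesis cfx :
  {within [set p : R * R | 0 <= p.1 <= 1], continuous (fun p => fx p.1 p.2)}.
Hypotheses (c1 : -1 < c)
  (fxc : forall t x : R, 0 <= t <= 1 -> c <= fx t x).

Let grid01 (i : 'I_N.-1) : 0 <= (i.+1%:R / N%:R : R) <= 1.
Proof.
have N0 : 0 < N%:R :> R by rewrite ltr0n (leq_trans _ N2).
rewrite divr_ge0//= ler_pdivrMr// mul1r ler_nat.
by rewrite (leq_trans (ltn_ord i))// leq_pred.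
Qed.

Let continuous_fx t : 0 <= t <= 1 -> continuous (fx t).
Proof.
move=> t01 x.
have := (subspace_continuousP _ _).1 cfx (t, x) t01.
(* A product neighbourhood of [(t, x)] is sliced at first coordinate [t]. *)
move=> H A /H [[B C] /= [tB xC] BC]; apply: filterS xC => z Cz.
by apply: (BC (t, z)) => //=; split=> //; exact: nbhs_singleton.
Qed.

Lemma DN_C1 : C1map (@DN R N f).
Proof.
apply: C1map_rV => i.
have -> : (fun x : 'rV[R]_(N.-1) => DN f x ord0 i) = fun x =>
    extE x i.+2 + ((-2) *: extE x i.+1 + (extE x i +
      (- (N%:R ^+ 2)^-1) *: f (i.+1%:R / N%:R) (extE x i.+1))).
  by apply/funext => x; rewrite mxE /GRing.scale /=; ring.
apply: C1mapD; first exact: C1map_extE.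
apply: C1mapD; first by apply: C1mapZ; exact: C1map_extE.
apply: C1mapD; first exact: C1map_extE.
apply: C1mapZ.
set t := i.+1%:R / N%:R; have t01 : 0 <= t <= 1 := grid01 i.
apply: (@C1map_comp_derive _ _ (fun x => extE x i.+1) (f t) (fx t)).
- by move=> x; exact: fD.
- exact: continuous_fx.
- exact: C1map_extE.
Qed.

(** The second difference contributes [- T], the term in [f] at most [- c * S / N^2], and Poincare
    gives [S / N^2 <= T]. *)
Lemma DN_coercive (x y : 'rV[R]_(N.-1)) :
  \sum_i (x - y) ord0 i * (DN f x - DN f y) ord0 i <=
  - ((1 + c) / N%:R ^+ 2) * \sum_i (x - y) ord0 i ^+ 2.
Proof.
have N0 : 0 < N%:R ^+ 2 :> R by rewrite exprn_gt0// ltr0n (leq_trans _ N2).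
have NE : N.-1.+1 = N by rewrite prednK// (leq_trans _ N2).
pose u := extE (x - y).
have uE (i : 'I_N.-1) : (x - y) ord0 i = u i.+1 by rewrite /u extE_ord.
have un : u N.-1.+1 = 0 by exact: extE_out.
pose T := \sum_(i < N.-1.+1) (u i.+1 - u i) ^+ 2.
pose S := \sum_(i < N.-1) u i.+1 ^+ 2.
have ST : S / N%:R ^+ 2 <= T.
  rewrite ler_pdivrMr// mulrC -{1}NE; exact: discrete_poincare.
rewrite [X in _ <= _ * X](_ : _ = S); last first.
  by apply: eq_bigr => i _; rewrite uE.
suff H : \sum_i (x - y) ord0 i * (DN f x - DN f y) ord0 i <=
    - T - c * S / N%:R ^+ 2.
  apply: (le_trans H); rewrite mulNr mulrDl mul1r mulrDl -!mulrA.
  by rewrite [_^-1 * S]mulrC; lra.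
(* Turning the energy back into a sum over interior points lets the bound be checked term by
   term. *)
rewrite /T -sum_by_parts_laplacian// /S mulr_sumr mulr_suml -sumrB.
apply: ler_sum => i _; rewrite !uE.
pose t : R := i.+1%:R / N%:R; have t01 : 0 <= t <= 1 := grid01 i.
have fm : c * (u i.+1) ^+ 2 <=
    u i.+1 * (f t (extE x i.+1) - f t (extE y i.+1)).
  rewrite /u extEB; apply: (@derive_ge_monotone _ _ (fx t)).
    by move=> z; exact: fD.
  by move=> z; exact: fxc.
have -> : (DN f x - DN f y) ord0 i = u i.+2 - 2 * u i.+1 + u i -
    (N%:R ^+ 2)^-1 * (f t (extE x i.+1) - f t (extE y i.+1)).
  by rewrite /u !extEB !mxE -/t; ring.
by rewrite mulrBr lerD2l lerN2 [leRHS]mulrCA [leRHS]mulrC ler_wpM2r// invr_ge0 ltW.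
Qed.

End Operator.

Unset Implicit Arguments.

(** The row vectors carry the sup norm; all norms on a finite-dimensional space are equivalent, so
    this covers both norms on $\mathbb{E}_N$. *)
Theorem theorem6 (R : realType) (N : nat) (f fx : R -> R -> R) :
  (2 <= N)%N ->
  (* C(c): f continuous on [0,1] x R, with continuous partial derivative fx
     with respect to the second variable *)
  {within [set p : R * R | 0 <= p.1 <= 1], continuous (fun p => f p.1 p.2)} ->
  (forall t x : R, 0 <= t <= 1 -> is_derive x 1 (f t) (fx t x)) ->
  {within [set p : R * R | 0 <= p.1 <= 1], continuous (fun p => fx p.1 p.2)} ->
  (* D(f) *)
  (exists A B : R, [/\ 0 < A, A < 1, 0 < B &
     forall t x : R, 0 <= t <= 1 -> `|f t x| <= A * `|x| + B]) ->
  (* D(f_x): inf over [0,1] x R of fx is > -1 *)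
  (exists c : R, -1 < c /\ forall t x : R, 0 <= t <= 1 -> c <= fx t x) ->
  diffeomorphism (@DN R N f).
Proof.
move=> N2 _ fD cfx _ [c [c1 fxc]].
have mu0 : 0 < (1 + c) / N%:R ^+ 2.
  rewrite divr_gt0//; first by lra.
  by rewrite exprn_gt0// ltr0n (leq_trans _ N2).
(* The constant of [coercive_norm_le] in dimension [N.-1], which is positive because [2 <= N]. *)
have K0 : 0 < N.-1%:R / ((1 + c) / N%:R ^+ 2).
  by rewrite divr_gt0// ltr0n; case: N N2 {mu0} => [|[]].
apply: (expanding_diffeomorphism K0); first exact: DN_C1 fD cfx.
by move=> x y; apply: coercive_norm_le => //; exact: DN_coercive fD fxc _ _.
Qed.
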